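(* Let $\gamma,R_{\mathrm{visc}},R_{\mathrm{surf}}\in\mathbb{R}^+$. Let $\varsigma=19+2\lfloor d/2\rfloor$ and $\varpi=17+2\lfloor d/2\rfloor$, and let $\mathcal{U}_s(\gamma,\mu,\sigma)$, $\mathcal{V}(\gamma,\mu,\sigma)$, $\mathcal{U}^{\mathrm{sub}}_s(\gamma,\mu,\sigma)$, $\mathcal{V}^{\mathrm{sub}}(\gamma,\mu,\sigma)$ be the fixed sets described in the context (they do not depend on $R_{\mathrm{visc}},R_{\mathrm{surf}}$). The following hold. (1) There exists a nonincreasing sequence of open sets $$\{0\}^{\ell+1}\times\{0\}^{\ell+1}\subset\widetilde{\mathcal{U}}_s(\gamma,R_{\mathrm{visc}},R_{\mathrm{surf}})\subset(H^\varsigma(\mathbb{R}^d;\mathbb{R}^{d\times d}))^{\ell+1}\times(H^\varsigma(\mathbb{R}^d;\mathbb{R}^d))^{\ell+1},\quad\mathbb{N}\ni s\ge\varsigma,$$ such that: (a) $\widetilde{\mathcal{U}}_s(\gamma,R_{\mathrm{visc}},R_{\mathrm{surf}})\subseteq\bigcap_{0\le\mu\le R_{\mathrm{visc}}}\bigcap_{0\le\sigma\le R_{\mathrm{surf}}}\mathcal{U}_s(\gamma,\mu,\sigma)$. (b) For each fixed $(\{\tau_i\}_{i=0}^\ell,\{\varphi_i\}_{i=0}^\ell)\in\widetilde{\mathcal{U}}_s(\gamma,R_{\mathrm{visc}},R_{\mathrm{surf}})\cap\big((H^s(\mathbb{R}^d;\mathbb{R}^{d\times d}))^{\ell+1}\times(H^s(\mathbb{R}^d;\mathbb{R}^d))^{\ell+1}\big)$,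 where $\mathbb{N}\ni s\ge\varsigma$, there exists a continuous mapping $$[0,R_{\mathrm{visc}}]\times[0,R_{\mathrm{surf}}]\ni(\mu,\sigma)\mapsto(v,\eta)\in H^s(\mathbb{R}^d;\mathbb{R}^d)\times\mathcal{H}^s(\mathbb{R}^d),$$ where $(v,\eta)$ is the solution in $\mathcal{V}(\gamma,\mu,\sigma)$ to $(\ast)$ with the omnisonic forcing. (c) For each mapping in (b), the following are well-defined and continuous between the stated spaces: $$[0,R_{\mathrm{visc}}]\times[0,R_{\mathrm{surf}}]\ni(\mu,\sigma)\mapsto(\mu\nabla v,\mu^2\nabla^2v)\in H^s(\mathbb{R}^d;\mathbb{R}^{d^2})\times H^s(\mathbb{R}^d;\mathbb{R}^{d^3})$$ and $$[0,R_{\mathrm{visc}}]\times[0,R_{\mathrm{surf}}]\ni(\mu,\sigma)\mapsto(\mu+\sigma)(\nabla\eta,\sigma\nabla^2\eta,\sigma^2\nabla^3\eta)\in H^s(\mathbb{R}^d;\mathbb{R}^d)\times H^s(\mathbb{R}^d;\mathbb{R}^{d^2})\times H^s(\mathbb{R}^d;\mathbb{R}^{d^3}).$$ (2) If additionally $\gamma<1$, then there exists an additional nonincreasing sequence of open sets $$\{0\}^{\ell+1}\times\{0\}^{\ell+1}\subset\widetilde{\mathcal{U}}^{\mathrm{sub}}_s(\gamma,R_{\mathrm{visc}},R_{\mathrm{surf}})\subset(H^\varpi(\mathbb{R}^d;\mathbb{R}^{d\times d}))^{\ell+1}\times(H^\varpi(\mathbb{R}^d;\mathbb{R}^d))^{\ell+1},\quad\mathbb{N}\ni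 s\ge\varpi,$$ such that: (a) $\widetilde{\mathcal{U}}^{\mathrm{sub}}_s(\gamma,R_{\mathrm{visc}},R_{\mathrm{surf}})\subseteq\bigcap_{0\le\mu\le R_{\mathrm{visc}}}\bigcap_{0\le\sigma\le R_{\mathrm{surf}}}\mathcal{U}^{\mathrm{sub}}_s(\gamma,\mu,\sigma)$. (b) For each $(\{\tau_i\}_{i=0}^\ell,\{\varphi_i\}_{i=0}^\ell)\in\widetilde{\mathcal{U}}^{\mathrm{sub}}_s(\gamma,R_{\mathrm{visc}},R_{\mathrm{surf}})\cap\big((H^s(\mathbb{R}^d;\mathbb{R}^{d\times d}))^{\ell+1}\times(H^s(\mathbb{R}^d;\mathbb{R}^d))^{\ell+1}\big)$, where $\mathbb{N}\ni s\ge\varpi$, there exists a continuous mapping $$[0,R_{\mathrm{visc}}]\times[0,R_{\mathrm{surf}}]\ni(\mu,\sigma)\mapsto(v,\eta)\in H^s(\mathbb{R}^d;\mathbb{R}^d)\times\mathcal{H}^{1+s}(\mathbb{R}^d),$$ where $(v,\eta)$ is the solution in $\mathcal{V}^{\mathrm{sub}}(\gamma,\mu,\sigma)$ to $(\ast)$ with the subsonic forcing. (c) For each mapping in (b), the following are well-defined and continuous between the stated spaces: $$[0,R_{\mathrm{visc}}]\times[0,R_{\mathrm{surf}}]\ni(\mu,\sigma)\mapsto(\mu\nabla v,\mu^2\nabla^2v)\in H^s(\mathbb{R}^d;\mathbb{R}^{d^2})\times H^s(\mathbb{R}^d;\mathbb{R}^{d^3})$$ and $$[0,R_{\mathrm{visc}}]\times[0,R_{\mathrm{surf}}]\ni(\mu,\sigma)\mapsto(\sigma\nabla\eta,\sigma^2\nabla^2\eta)\in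 H^{1+s}(\mathbb{R}^d;\mathbb{R}^d)\times H^{1+s}(\mathbb{R}^d;\mathbb{R}^{d^2}).$$
   Context: $d\in\mathbb{N}^+$ and $\ell\in\mathbb{N}=\{0,1,2,\dots\}$ are fixed; $\mathbb{R}^+=(0,\infty)$; $e_1$ is the first standard basis vector of $\mathbb{R}^d$; $\mathbb{S}v=\nabla v+\nabla v^{\mathrm{t}}+2(\nabla\cdot v)I_{d\times d}$. $\mathscr{F}$ is the Fourier transform (unitary on $L^2$, with $\partial_j$ having symbol $2\pi i\xi_j$), $\langle x\rangle=\sqrt{1+|x|^2}$, $|\nabla|$ has symbol $2\pi|\xi|$, and $\langle c\nabla\rangle^2=1-c^2\Delta$. For real $s\ge0$, $\mathcal{H}^s(\mathbb{R}^d)$ is the Hilbert space of real-valued tempered distributions $f$ with $\mathscr{F}[f]\in L^1_{\mathrm{loc}}(\mathbb{R}^d;\mathbb{C})$ and finite norm $$\|f\|_{\mathcal{H}^s}=\Big(\int_{\mathbb{R}^d}\big(|\xi|^{-2}(\xi_1^2+|\xi|^4)\mathbf 1_{B(0,1)}(\xi)+\langle\xi\rangle^{2s}\mathbf 1_{\mathbb{R}^d\setminus B(0,1)}(\xi)\big)|\mathscr{F}[f](\xi)|^2\,d\xi\Big)^{1/2}.$$ The system (traveling shallow water equations with wave speed $\gamma$, viscosity parameter $\mu$, surface tension parameter $\sigma$) is $$(\ast)\quad\begin{cases}\nabla\cdot((1+\eta)(v-\gamma e_1))=0,\\ (1+\eta)(v-\gamma e_1)\cdot\nabla v+v-\mu^2\nabla\cdot((1+\eta)\mathbb{S}v)+(1+\eta)(I-\sigma^2\Delta)\nabla\eta+\mathcal{F}=0,\end{cases}$$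 for $v:\mathbb{R}^d\to\mathbb{R}^d$, $\eta:\mathbb{R}^d\to\mathbb{R}$. For data $\tau_i:\mathbb{R}^d\to\mathbb{R}^{d\times d}$, $\varphi_i:\mathbb{R}^d\to\mathbb{R}^d$, the omnisonic forcing is $\mathcal{F}=\sum_{i=0}^\ell\eta^i((\mathrm{Tr}\,\tau_i)\nabla\eta+(\mu+\sigma)\tau_i\nabla\eta+\varphi_i)$ and the subsonic forcing is $\mathcal{F}=\sum_{i=0}^\ell\eta^i(\tau_i\nabla\eta+\varphi_i)$, with $\eta^0=1$. Write $\mathbb{W}_s=(H^s(\mathbb{R}^d;\mathbb{R}^{d\times d}))^{\ell+1}\times(H^s(\mathbb{R}^d;\mathbb{R}^d))^{\ell+1}$. Previously fixed sets, omnisonic case. The small-data well-posedness theorem for $(\ast)$ provides sets, fixed once and for all before $\gamma,R_{\mathrm{visc}},R_{\mathrm{surf}}$ are chosen: a nonincreasing sequence of relatively open sets $\mathbb{R}^+\times[0,\infty)^2\times\{0\}^{\ell+1}\times\{0\}^{\ell+1}\subset\mathcal{U}_s\subset\mathbb{R}^+\times[0,\infty)^2\times\mathbb{W}_\varsigma$, $\mathbb{N}\ni s\ge\varsigma$, and open sets $0\in\mathcal{V}(\mathfrak{q})\subset H^\varsigma(\mathbb{R}^d;\mathbb{R}^d)\times\mathcal{H}^\varsigma(\mathbb{R}^d)$, $\mathfrak{q}\in\mathbb{R}^+\times[0,\infty)^2$, such that: (i) for all $(\gamma,\mu,\sigma,\{\tau_i\},\{\varphi_i\})\in\mathcal{U}_\varsigma$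 there is a unique $(v,\eta)\in\mathcal{V}(\gamma,\mu,\sigma)$ classically satisfying $(\ast)$ with omnisonic forcing; (ii) if $s\ge\varsigma$ and $(\gamma,\mu,\sigma,\{\tau_i\},\{\varphi_i\})\in\mathcal{U}_s\cap(\mathbb{R}^3\times\mathbb{W}_s)$, then this solution has $\langle\mu\nabla\rangle^2v\in H^s(\mathbb{R}^d;\mathbb{R}^d)$ and $(1+(\mu+\sigma)|\nabla|)\langle\sigma\nabla\rangle^2\eta\in\mathcal{H}^s(\mathbb{R}^d)$; (iii) for $s\ge\varsigma$, the maps from $\mathcal{U}_s\cap(\mathbb{R}^3\times\mathbb{W}_s)$ sending $(\gamma,\mu,\sigma,\{\tau_i\},\{\varphi_i\})$ to $(v,\eta)\in H^s\times\mathcal{H}^s$, to $(\mu\nabla v,\mu^2\nabla^2v)\in H^s\times H^s$, and to $(\mu+\sigma)(\nabla\eta,\sigma\nabla^2\eta,\sigma^2\nabla^3\eta)\in H^s\times H^s\times H^s$ are continuous. The slices are $\mathcal{U}_s(\gamma,\mu,\sigma)=\mathrm{int}\{(\{\tau_i\},\{\varphi_i\}):(\gamma,\mu,\sigma,\{\tau_i\},\{\varphi_i\})\in\mathcal{U}_s\}$, where $\mathrm{int}$ is the topological interior in $\mathbb{W}_\varsigma$. Previously fixed sets, subsonic case. Likewise, fixed once and for all: a nonincreasing sequence of relatively open sets $(0,1)\times[0,\infty)^2\times\{0\}^{\ell+1}\times\{0\}^{\ell+1}\subset\mathcal{U}^{\mathrm{sub}}_s\subset(0,1)\times[0,\infty)^2\times\mathbb{W}_\varpi$,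 $\mathbb{N}\ni s\ge\varpi$, and open sets $0\in\mathcal{V}^{\mathrm{sub}}(\mathfrak{q})\subset H^\varpi(\mathbb{R}^d;\mathbb{R}^d)\times\mathcal{H}^{1+\varpi}(\mathbb{R}^d)$, $\mathfrak{q}\in(0,1)\times[0,\infty)^2$, such that: for all $(\gamma,\mu,\sigma,\{\tau_i\},\{\varphi_i\})\in\mathcal{U}^{\mathrm{sub}}_\varpi$ there is a unique $(v,\eta)\in\mathcal{V}^{\mathrm{sub}}(\gamma,\mu,\sigma)$ classically satisfying $(\ast)$ with subsonic forcing; and, for $s\ge\varpi$ and parameters and data in $\mathcal{U}^{\mathrm{sub}}_s\cap(\mathbb{R}^3\times\mathbb{W}_s)$, this solution has $\langle\mu\nabla\rangle^2v\in H^s$, $\langle\sigma\nabla\rangle^2\eta\in\mathcal{H}^{1+s}$, and the maps to $(v,\eta)\in H^s\times\mathcal{H}^{1+s}$, $(\mu\nabla v,\mu^2\nabla^2v)\in H^s\times H^s$, and $(\sigma\nabla\eta,\sigma^2\nabla^2\eta)\in H^{1+s}\times H^{1+s}$ are continuous. The slices are $\mathcal{U}^{\mathrm{sub}}_s(\gamma,\mu,\sigma)=\mathrm{int}\{(\{\tau_i\},\{\varphi_i\}):(\gamma,\mu,\sigma,\{\tau_i\},\{\varphi_i\})\in\mathcal{U}^{\mathrm{sub}}_s\}$, with interior in $\mathbb{W}_\varpi$. *)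

(* Defs.v *)
From HB Require Import structures.
From mathcomp Require Import all_boot all_order all_algebra.
From mathcomp Require Import complex.
From mathcomp Require Import all_classical all_reals all_analysis measurable_realfun.
From mathcomp Require Import lra.

Set Implicit Arguments.
Unset Strict Implicit.
Unset Printing Implicit Defensive.

Import Order.TTheory GRing.Theory Num.Theory.
Import numFieldNormedType.Exports.

Local Open Scope classical_set_scope.
Local Open Scope ring_scope.

(* The dimension d >= 1 is written n.+1 throughout, and R^d is 'rV[R]_n.+1.
   The library norm of 'rV[R]_n.+1 is the sup norm; the Euclidean norm is enorm. *)

(* R^n carries the sigma-algebra generated by the coordinates, which contains
   the open sets (open_measurable_rV). *)
Section borel_rV.
Variables (R : realType) (n : nat).

Let coors (i : 'I_n) (x : 'rV[R]_n) : R := x 0 i.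

Let rV_set0 : g_sigma_preimage coors set0.
Proof. exact: sigma_algebra0. Qed.

Let rV_setC A : g_sigma_preimage coors A -> g_sigma_preimage coors (~` A).
Proof. exact: sigma_algebraC. Qed.

Let rV_bigcup (F : _^nat) : (forall i, g_sigma_preimage coors (F i)) ->
  g_sigma_preimage coors (\bigcup_i (F i)).
Proof. exact: sigma_algebra_bigcup. Qed.

HB.instance Definition _ := @isMeasurable.Build default_measure_display
  'rV[R]_n (g_sigma_preimage coors) rV_set0 rV_setC rV_bigcup.

End borel_rV.

Lemma measurable_coord (R : realType) n (i : 'I_n) :
  measurable_fun [set: 'rV[R]_n] (fun x : 'rV[R]_n => x 0 i).
Proof.
move=> _ Y mY; rewrite setTI; apply: sub_sigma_algebra => /=.
rewrite -bigcup_seq/=; exists i => /=; first by rewrite mem_index_enum.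
by exists Y => //; rewrite setTI.
Qed.

Lemma measurable_fun_rVP (R : realType) n d (T : measurableType d) (f : T -> 'rV[R]_n) :
  (forall i, measurable_fun setT (fun t => f t 0 i)) -> measurable_fun setT f.
Proof.
move=> mf; pose coor (i : 'I_n) (x : 'rV[R]_n) : R := x 0 i.
have : g_sigma_preimage (fun i => coor i \o f) `<=` measurable.
  apply: smallest_sub; first exact: sigma_algebra_measurable.
  case: n f mf @coor => [|m] f mf coor; first by rewrite big_ord0.
  rewrite -bigcup_mkord_ord; apply: bigcup_sub => i Ii.
  by move=> A [B mB <-]; exact: mf.
rewrite g_sigma_preimage_comp => prefS.
by move=> _ A mA; apply: prefS; exists A.
Qed.


Section lebesgue_rV.
Variable R : realType.
Local Open Scope ereal_scope.

Definition rV_cons n (p : R * 'rV[R]_n) : 'rV[R]_n.+1 :=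
  \row_i (if unlift ord0 i is Some j then p.2 0%R j else p.1).

Definition rV_uncons n (x : 'rV[R]_n.+1) : R * 'rV[R]_n :=
  (x 0%R ord0, \row_i x 0%R (lift ord0 i)).

Lemma rV_consK n : cancel (@rV_cons n) (@rV_uncons n).
Proof.
move=> [a t]; rewrite /rV_uncons mxE unlift_none; congr pair.
by apply/rowP => i; rewrite !mxE liftK.
Qed.

Lemma measurable_rV_cons n : measurable_fun setT (@rV_cons n).
Proof.
apply: measurable_fun_rVP => i; rewrite /rV_cons.
under eq_fun do rewrite mxE.
by case: unliftP => [j|] _; [|exact: measurable_fst];
  apply: (measurableT_comp (@measurable_coord _ _ j)); exact: measurable_snd.
Qed.

Lemma measurable_rV_uncons n : measurable_fun setT (@rV_uncons n).
Proof.
apply/measurable_fun_pairP; split; first exact: measurable_coord.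
apply: measurable_fun_rVP => i /=; rewrite [X in measurable_fun _ X](_ : _ = (fun x : 'rV[R]_n.+1 => x 0%R (lift ord0 i))); first exact: measurable_coord.
by apply/funext => x; rewrite /= mxE.
Qed.

Section cons_measure.
Variables (n : nat) (m : {sigma_finite_measure set 'rV[R]_n -> \bar R}).
Definition cons_measure : set 'rV[R]_n.+1 -> \bar R :=
  pushforward (@lebesgue_measure R \x m) (@rV_cons n).

Let m0 : cons_measure set0 = 0.
Proof. by rewrite /cons_measure /pushforward preimage_set0 measure0. Qed.
Let mge0 A : 0 <= cons_measure A.
Proof. by rewrite /cons_measure /pushforward; exact: measure_ge0. Qed.
Let mF : semi_sigma_additive cons_measure.
Proof.
move=> F mF tF mUF; rewrite /cons_measure /pushforward preimage_bigcup.
apply: measure_semi_sigma_additive.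
- by move=> k; rewrite -[X in measurable X]setTI; exact: measurable_rV_cons.
- apply/trivIsetP => /= i j _ _ ij; rewrite -preimage_setI.
  by move/trivIsetP : tF => /(_ _ _ _ _ ij) ->//; rewrite preimage_set0.
- by rewrite -preimage_bigcup -[X in measurable X]setTI; exact: measurable_rV_cons.
Qed.
HB.instance Definition _ := isMeasure.Build _ _ _ cons_measure m0 mge0 mF.
Let mS : sigma_finite setT cons_measure.
Proof.
have /sigma_finiteP[G [GT ndG Goo]] := sigma_finiteT (@lebesgue_measure R).
have /sigma_finiteP[H [HT ndH Hoo]] := sigma_finiteT m.
pose F k := G k `*` H k; have FT : setT = \bigcup_k F k.
  rewrite -setXTT GT HT predeqE => -[x y]; split.
    move=> [/= [i _ Gix] [j _ Hjy]]; exists (maxn i j) => //; split.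
    - by move: x Gix; exact/subsetPset/ndG/leq_maxl.
    - by move: y Hjy; exact/subsetPset/ndH/leq_maxr.
  by move=> [i _ []/= ? ?]; split; exists i.
have Foo k : measurable (F k) /\ (@lebesgue_measure R \x m) (F k) < +oo.
  have [? ?] := Goo k; have [? ?] := Hoo k; split; first exact: measurableX.
  by rewrite product_measure1E// lte_mul_pinfty// ge0_fin_numE.
exists (fun k => @rV_uncons n @^-1` F k).
  by rewrite -preimage_bigcup -FT preimage_setT.
move=> k; split.
  by rewrite -[X in measurable X]setTI; apply: measurable_rV_uncons => //; case: (Foo k).
rewrite /cons_measure /pushforward -comp_preimage.
rewrite (_ : _ \o _ = id) ?preimage_id; first by case: (Foo k).
by apply/funext => p /=; rewrite rV_consK.
Qed.
HB.instance Definition _ := Measure_isSigmaFinite.Build _ _ _ cons_measure mS.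
End cons_measure.

(* n-dimensional Lebesgue measure, as an iterated product. *)
Fixpoint leb n : {sigma_finite_measure set 'rV[R]_n -> \bar R} :=
  if n is n'.+1 then cons_measure (leb n') else dirac (0%R : 'rV[R]_0).

End lebesgue_rV.

Section distributions.
Variables (R : realType) (n : nat).
Local Notation pt := 'rV[R]_n.+1.
Local Open Scope complex_scope.
Local Notation Re := complex.Re.
Local Notation Im := complex.Im.

Definition dot (x y : pt) : R := \sum_i x 0 i * y 0 i.
Definition enorm (x : pt) : R := Num.sqrt (dot x x).
Definition bracket (x : pt) : R := Num.sqrt (1 + dot x x).

Definition partial (j : 'I_n.+1) (f : pt -> R) : pt -> R :=
  fun x => 'D_(delta_mx 0 j) (f : pt -> R^o) x.
Definition partials (js : seq 'I_n.+1) (f : pt -> R) : pt -> R := foldr partial f js.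

(* All partial derivatives of order at most k exist and are continuous. *)
Definition Ck (k : nat) (f : pt -> R) : Prop :=
  forall js, ((size js <= k)%N -> continuous (partials js f)) /\
    ((size js < k)%N -> forall j x,
       derivable (partials js f : pt -> R^o) x (delta_mx 0 j)).
Definition smooth (f : pt -> R) : Prop := forall k, Ck k f.

Definition schwartz (f : pt -> R) : Prop :=
  smooth f /\
  forall N js, exists C, forall x, bracket x ^+ N * `|partials js f x| <= C.

Definition test_fun (f : pt -> R) : Prop :=
  smooth f /\ exists B, forall x, B < enorm x -> f x = 0.

(* A real-valued tempered distribution is given by its values on real Schwartz
   functions and extended to complex ones by complex linearity (cpair). It is
   made total by the value 0 outside the Schwartz space, so that Leibniz equality
   is equality of distributions. *)
Definition functional := (pt -> R) -> R.

Definition tempered (f : functional) : Prop :=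
  [/\ forall phi, ~ schwartz phi -> f phi = 0,
      forall a phi psi, schwartz phi -> schwartz psi ->
        f (fun x => a * phi x + psi x) = a * f phi + f psi &
      exists N C, forall phi B, schwartz phi ->
        (forall js x, (size js <= N)%N -> bracket x ^+ N * `|partials js phi x| <= B) ->
        `|f phi| <= C * B].

Definition cint (g : pt -> R[i]) : R[i] :=
  (\int[leb R n.+1]_x Re (g x)) +i* (\int[leb R n.+1]_x Im (g x)).

Definition fourier (phi : pt -> R[i]) (xi : pt) : R[i] :=
  cint (fun x => phi x * (cos (2 * pi * dot x xi) -i* sin (2 * pi * dot x xi))).

Definition cpair (f : functional) (phi : pt -> R[i]) : R[i] :=
  f (fun x => Re (phi x)) +i* f (fun x => Im (phi x)).

(* Local integrability on R^d; enorm x <= B describes closed balls. *)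
Definition locint (F : pt -> R) : Prop :=
  measurable_fun setT F /\
  forall B : R, (leb R n.+1).-integrable [set x | enorm x <= B] (EFin \o F).

(* The Fourier transform of f is the locally integrable function F: the two
   distributions agree on the smooth compactly supported complex functions. *)
Definition fourier_rep (f : functional) (F : pt -> R[i]) : Prop :=
  [/\ locint (fun xi => Re (F xi)), locint (fun xi => Im (F xi)) &
      forall phi : pt -> R[i],
        test_fun (fun x => Re (phi x)) -> test_fun (fun x => Im (phi x)) ->
        cpair f (fourier phi) = cint (fun xi => F xi * phi xi)].

Definition l2norm (w : pt -> R) (F : pt -> R[i]) : \bar R :=
  'N[leb R n.+1]_2%:E[
    (fun xi => (Num.sqrt (w xi) * Normc.normc (F xi))%:E)]%E.

(* The norm (\int w |F[f]|^2)^(1/2). The locally integrable function F[f] is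
   unique up to null sets, so the infimum is over at most one value; it is +oo
   when F[f] is not locally integrable. *)
Definition wnorm (w : pt -> R) (f : functional) : \bar R :=
  ereal_inf [set l2norm w F | F in fourier_rep f].

Definition in_wspace w (f : functional) : Prop :=
  tempered f /\ (wnorm w f < +oo)%E.


Lemma measurable_sqrt : measurable_fun setT (@Num.sqrt R).
Proof. by apply: continuous_measurable_fun; exact: sqrt_continuous. Qed.

Lemma measurable_dot : measurable_fun setT (fun x : pt => dot x x).
Proof.
by apply: measurable_sum => i; apply: measurable_funM; exact: measurable_coord.
Qed.

Lemma measurable_enorm : measurable_fun setT enorm.
Proof. by apply: measurableT_comp measurable_dot; exact: measurable_sqrt. Qed.

Lemma measurable_bracket : measurable_fun setT bracket.
Proof.
apply: (measurableT_comp measurable_sqrt).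
by apply: measurable_funD => //; exact: measurable_dot.
Qed.

Lemma measurable_eball (B : R) : measurable [set x : pt | enorm x <= B].
Proof.
have := measurable_enorm measurableT (measurable_itv `]-oo, B]).
rewrite setTI (_ : _ @^-1` _ = [set x : pt | enorm x <= B])//.
Qed.

Lemma locintN F : locint F -> locint (fun xi => - F xi).
Proof.
move=> [mF iF]; split; first exact: measurable_funN.
by move=> B; exact: integrableN (iF B).
Qed.

Lemma locintD F G : locint F -> locint G -> locint (fun xi => F xi + G xi).
Proof.
move=> [mF iF] [mG iG]; split; first exact: measurable_funD.
move=> B; refine (integrableD (measurable_eball B) (iF B) (iG B)).
Qed.


Lemma coord_le_enorm (x : pt) i : `|x 0 i| <= enorm x.
Proof.
rewrite -sqrtr_sqr ler_wsqrtr// /dot (bigD1 i)//= -expr2 lerDl.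
by apply: sumr_ge0 => j _; rewrite -expr2 sqr_ge0.
Qed.

Lemma norm_le_enorm (x : pt) : `|x| <= enorm x.
Proof.
rewrite [leLHS]mx_normrE; apply/bigmax_leP; split; first exact: sqrtr_ge0.
by move=> [a b] _ /=; rewrite (ord1 a); exact: coord_le_enorm.
Qed.

Lemma open_measurable_rV (U : set pt) : open U -> measurable U.
Proof.
move=> oU.
pose box (qr : {ffun 'I_n.+1 -> rat} * rat) : set pt :=
  [set x | forall i, ratr (qr.1 i) - ratr qr.2 < x 0 i < ratr (qr.1 i) + ratr qr.2].
have mbox qr : measurable (box qr).
  rewrite (_ : box qr = \bigcap_(i in [set: 'I_n.+1]) ((fun x : pt => x 0 i) @^-1`
    `]ratr (qr.1 i) - ratr qr.2, ratr (qr.1 i) + ratr qr.2[%classic)).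
    apply: fin_bigcap_measurable => // i _.
    rewrite -[X in measurable X]setTI; apply: measurable_coord => //.
  by apply/seteqP; split => x /= h i; [move=> _; rewrite /= in_itv/=; exact: h|have := h i I; rewrite /= in_itv].
rewrite (_ : U = \bigcup_qr (if `[< box qr `<=` U >] then box qr else set0)).
  apply: countable_bigcupT_measurable => // qr; case: asboolP => // _.
apply/seteqP; split => [x Ux|x [qr _]]; last by case: asboolP => [bU|_] // /bU.
have /nbhs_ballP[e /= e0 xeU] : nbhs x U by exact: open_nbhs_nbhs.
have [r /andP[r0 re]] : exists r : rat, 0 < (ratr r : R) < e / 2.
  have [r] := @rat_in_itvoo R 0 (e / 2) (divr_gt0 e0 (ltr0n _ 2)).
  by rewrite in_itv/= => ?; exists r.
have qP i : exists q : rat, x 0 i - ratr r < ratr q < x 0 i + ratr r.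
  have [|q] := @rat_in_itvoo R (x 0 i - ratr r) (x 0 i + ratr r).
    by rewrite ltrBlDr -addrA ltrDl addr_gt0.
  by rewrite in_itv/= => ?; exists q.
pose q : {ffun 'I_n.+1 -> rat} := [ffun i => projT1 (cid (qP i))].
have qE i : x 0 i - ratr r < ratr (q i) < x 0 i + ratr r.
  by rewrite ffunE; case: cid.
exists (q, r) => //; case: asboolP => [_ i|].
  by move: (qE i) => /= /andP[]; rewrite ltrBlDr ltrBlDl => -> ?; rewrite addrC; apply/andP; split => //; rewrite ltrBlDr addrC.
move=> nbU; exfalso; apply: nbU => y yb; apply: xeU; split => // a b; rewrite (ord1 a).
rewrite /ball/= ; move: (yb b) (qE b) => /=; rewrite ltr_norml => /andP[? ?] /andP[? ?].
by apply/andP; split; lra.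
Qed.

Lemma continuous_measurable_rV (f : pt -> R) :
  continuous f -> measurable_fun setT f.
Proof.
move=> /continuousP cf; apply: (measurability _ (RGenOpens.measurableE R)).
move=> _ [_ [a [b ->]] <-]; rewrite setTI; apply: open_measurable_rV.
by apply: cf; exact: interval_open.
Qed.

Lemma locint_test F phi : locint F -> test_fun phi ->
  (leb R n.+1).-integrable setT (EFin \o (fun xi => F xi * phi xi)).
Proof.
move=> [mF iF] [sphi [B phiB]].
have cphi : continuous phi by have [/(_ isT)] := sphi 0%N [::].
have mphi := continuous_measurable_rV cphi.
have bphi : [bounded phi x | x in [set: pt]].
  have /compact_bounded[M [Mreal MB]] : compact (phi @` closed_ball_ Num.norm 0 B).
    apply: continuous_compact; first exact: continuous_subspaceT.
    apply: bounded_closed_compact; last exact: closed_closed_ball_.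
    exists B; split; first exact: num_real. move=> y By x; rewrite /closed_ball_ /= sub0r normrN => /le_trans; apply; exact: ltW.
  exists (Num.max 0 M); split; first exact: num_real.
  move=> y; rewrite gt_max => /andP[y0 My] x _ /=.
  have [xB|xB] := leP `|x| B; first by apply: (MB _ My); exists x => //; rewrite /closed_ball_ /= sub0r normrN.
  by rewrite phiB ?normr0 ?ltW// (lt_le_trans xB)// norm_le_enorm.
have /(integrable_mkcond _ (measurable_eball B)) iFD := iF B.
apply: (eq_integrable measurableT) (integrableMr measurableT mphi bphi iFD) => //= xi _.
rewrite /= patchE; case: ifPn => [_|]; first by rewrite -EFinM mulrC.
by rewrite notin_setE /= => /negP; rewrite -ltNge => /phiB ->; rewrite mulr0 mule0.
Qed.

Lemma fourier_rep0 : fourier_rep (fun=> 0) (fun=> 0).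
Proof.
have l0 : locint (fun=> 0).
  by split=> [|B]; [exact: measurable_cst|exact: integrable0].
split=> // phi _ _; rewrite /cpair /cint.
have Re0 x : Re (0 * phi x) = 0 by rewrite mul0r.
have Im0 x : Im (0 * phi x) = 0 by rewrite mul0r.
under [in RHS]eq_Rintegral do rewrite Re0.
under [X in _ = _ +i* X]eq_Rintegral do rewrite Im0.
by rewrite !Rintegral_cst// mul0r.
Qed.

Lemma ReM (z w : R[i]) : Re (z * w) = Re z * Re w - Im z * Im w.
Proof. by case: z; case: w. Qed.

Lemma ImM (z w : R[i]) : Im (z * w) = Re z * Im w + Im z * Re w.
Proof. by case: z; case: w. Qed.

Lemma ReD (z w : R[i]) : Re (z + w) = Re z + Re w.
Proof. by case: z; case: w. Qed.

Lemma ImD (z w : R[i]) : Im (z + w) = Im z + Im w.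
Proof. by case: z; case: w. Qed.

Lemma ReN (z : R[i]) : Re (- z) = - Re z.
Proof. by case: z. Qed.

Lemma ImN (z : R[i]) : Im (- z) = - Im z.
Proof. by case: z. Qed.

Lemma integrable_mulc F phi :
  locint (fun xi => Re (F xi)) -> locint (fun xi => Im (F xi)) ->
  test_fun (fun x => Re (phi x)) -> test_fun (fun x => Im (phi x)) ->
  (leb R n.+1).-integrable setT (EFin \o (fun xi => Re (F xi * phi xi))) /\
  (leb R n.+1).-integrable setT (EFin \o (fun xi => Im (F xi * phi xi))).
Proof.
move=> rF iF rphi iphi; split.
  apply: (eq_integrable measurableT) (integrableB measurableT (locint_test rF rphi) (locint_test iF iphi)) => //= xi _.
  by rewrite /= ReM.
apply: (eq_integrable measurableT) (integrableD measurableT (locint_test rF iphi) (locint_test iF rphi)) => //= xi _.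
by rewrite /= ImM.
Qed.

Lemma RintegralN_T (f : pt -> R) : (leb R n.+1).-integrable setT (EFin \o f) ->
  \int[leb R n.+1]_x (- f x) = - \int[leb R n.+1]_x f x.
Proof.
by move=> fi; under eq_Rintegral do rewrite -mulN1r; rewrite RintegralZl// mulN1r.
Qed.

Lemma fourier_repN f F : fourier_rep f F ->
  fourier_rep (fun phi => - f phi) (fun xi => - F xi).
Proof.
move=> [rF iF fF]; split.
- by under eq_fun do rewrite ReN; exact: locintN.
- by under eq_fun do rewrite ImN; exact: locintN.
move=> phi rphi iphi; have [rI iI] := integrable_mulc rF iF rphi iphi.
have := fF _ rphi iphi; rewrite /cpair /cint => -[-> ->].
under [in RHS]eq_Rintegral do rewrite mulNr ReN.
by under [X in _ = _ +i* X]eq_Rintegral do rewrite mulNr ImN; rewrite !RintegralN_T.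
Qed.

Lemma fourier_repD f g F G : fourier_rep f F -> fourier_rep g G ->
  fourier_rep (f \+ g) (fun xi => F xi + G xi).
Proof.
move=> [rF iF fF] [rG iG gG]; split.
- by under eq_fun do rewrite ReD; exact: locintD.
- by under eq_fun do rewrite ImD; exact: locintD.
move=> phi rphi iphi; have [rFI iFI] := integrable_mulc rF iF rphi iphi.
have [rGI iGI] := integrable_mulc rG iG rphi iphi.
have := fF _ rphi iphi; rewrite /cpair /cint /= => -[-> ->].
have := gG _ rphi iphi; rewrite /cpair /cint /= => -[-> ->].
under [in RHS]eq_Rintegral do rewrite mulrDl ReD.
by under [X in _ = _ +i* X]eq_Rintegral do rewrite mulrDl ImD; rewrite !RintegralD.
Qed.

Lemma measurable_normc F : locint (fun xi => Re (F xi)) ->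
  locint (fun xi => Im (F xi)) ->
  measurable_fun setT (fun xi => Normc.normc (F xi)).
Proof.
move=> [rF _] [iF _].
rewrite (_ : (fun _ => _) = (fun xi => Num.sqrt (Re (F xi) ^+ 2 + Im (F xi) ^+ 2))).
  apply: (measurableT_comp measurable_sqrt).
  by apply: measurable_funD; exact: measurable_funX.
by apply/funext => xi; case: (F xi).
Qed.

Lemma wnorm_lt w f (e : \bar R) :
  (wnorm w f < e)%E <-> exists2 F, fourier_rep f F & (l2norm w F < e)%E.
Proof.
split=> [/ereal_inf_lt[_ [F fF <-] Fe]|[F fF Fe]]; first by exists F.
by apply: le_lt_trans Fe; apply: ereal_inf_lbound; exists F.
Qed.

Lemma l2norm0 w : l2norm w (fun=> 0) = 0%E.
Proof.
rewrite /l2norm.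
rewrite (_ : (fun xi => _) = cst 0%E) ?Lnorm0//.
by apply/funext => xi; rewrite Normc.normc0 mulr0.
Qed.

Lemma l2normN w F : l2norm w (fun xi => - F xi) = l2norm w F.
Proof.
by rewrite /l2norm; under [X in Lnorm _ _ X]eq_fun do rewrite normcN.
Qed.

Lemma ler_l2normD (w : {mfun pt >-> R}) (F G : pt -> R[i]) :
  measurable_fun setT (fun xi => Normc.normc (F xi)) ->
  measurable_fun setT (fun xi => Normc.normc (G xi)) ->
  measurable_fun setT (fun xi => Normc.normc (F xi + G xi)) ->
  (l2norm w (fun xi => F xi + G xi)%R <= l2norm w F + l2norm w G)%E.
Proof.
move=> mF mG mFG.
have mw : measurable_fun setT (fun xi => Num.sqrt (w xi)).
  by apply: (measurableT_comp measurable_sqrt); exact: measurable_funP.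
have mwM (H : pt -> R) : measurable_fun setT H -> measurable_fun setT (fun xi => Num.sqrt (w xi) * H xi).
  exact: measurable_funM.
apply: le_trans (minkowski_EFin (leb R n.+1) (mwM _ mF) (mwM _ mG) (ler1n _ 2)).
rewrite /l2norm unlock; apply: gt0_ler_poweR.
- by rewrite invr_ge0.
- by rewrite in_itv/= leey andbT; apply: integral_ge0 => x _; rewrite /= lee_fin powR_ge0.
- by rewrite in_itv/= leey andbT; apply: integral_ge0 => x _; rewrite /= lee_fin powR_ge0.
apply: ge0_le_integral => //.
- by move=> x _; rewrite /= lee_fin powR_ge0.
- apply/measurable_EFinP/(measurableT_comp (measurable_powR _)).
  by apply: measurableT_comp => //; exact: mwM.
- apply/measurable_EFinP/(measurableT_comp (measurable_powR _)).
  by apply: measurableT_comp => //; apply: measurable_funD; exact: mwM.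
move=> x _ /=; rewrite lee_fin ge0_ler_powR ?nnegrE ?normr_ge0//.
rewrite -mulrDr !normrM ler_wpM2l// !ger0_norm ?addr_ge0 //.
- exact: le_normcD.
- by case: (F x) => a b; exact: sqrtr_ge0.
- by case: (G x) => a b; exact: sqrtr_ge0.
- by case: (F x + G x) => a b; exact: sqrtr_ge0.
Qed.

End distributions.

Arguments functional R n : clear implicits.
Arguments Ck {R n}.

Section weighted_space.
Variables (R : realType) (n : nat) (w : {mfun 'rV[R]_n.+1 >-> R}).
Local Open Scope complex_scope.
Local Notation Re := complex.Re.
Local Notation Im := complex.Im.

(* Real-valued tempered distributions with locally integrable Fourier transform
   and finite norm, with the topology of that norm. *)
Record wspace : Type := WSpace {
  wdist : functional R n ;
  wdistP : in_wspace w wdist }.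

HB.instance Definition _ := gen_eqMixin wspace.
HB.instance Definition _ := gen_choiceMixin wspace.

Definition wball (f : wspace) (e : R) (g : wspace) : Prop :=
  (wnorm w (wdist f \- wdist g)%R < e%:E)%E.

HB.instance Definition _ := hasNbhs.Build wspace (nbhs_ (entourage_ wball)).

Let wball_center f (e : R) : 0 < e -> wball f e f.
Proof.
move=> e0; apply/wnorm_lt; exists (fun=> 0); last by rewrite l2norm0 lte_fin.
rewrite (_ : _ \- _ = fun=> 0); first exact: fourier_rep0.
by apply/funext => phi /=; rewrite subrr.
Qed.

Let wball_sym f g (e : R) : wball f e g -> wball g e f.
Proof.
move=> /wnorm_lt[F rF Fe]; apply/wnorm_lt; exists (fun xi => - F xi).
  rewrite (_ : _ \- _ = fun phi => - (wdist f \- wdist g) phi); first exact: fourier_repN.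
  by apply/funext => phi /=; rewrite opprB.
by rewrite l2normN.
Qed.

Let wball_triangle f g h (e1 e2 : R) :
  wball f e1 g -> wball g e2 h -> wball f (e1 + e2) h.
Proof.
move=> /wnorm_lt[F rF Fe] /wnorm_lt[G rG Ge]; apply/wnorm_lt.
exists (fun xi => F xi + G xi).
  rewrite (_ : _ \- _ = (wdist f \- wdist g) \+ (wdist g \- wdist h)).
    exact: fourier_repD.
  by apply/funext => phi /=; rewrite addrA subrK.
have rFG := fourier_repD rF rG.
apply: le_lt_trans (lteD Fe Ge); apply: ler_l2normD.
- by case: rF => *; exact: measurable_normc.
- by case: rG => *; exact: measurable_normc.
- by case: rFG => *; exact: measurable_normc.
Qed.

HB.instance Definition _ := Nbhs_isPseudoMetric.Build R wspace
  erefl wball_center wball_sym wball_triangle erefl.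

Lemma in_wspace0 : in_wspace w (fun=> 0).
Proof.
split.
  split=> //; first by move=> *; rewrite mulr0 addr0.
  exists 0%N, 0 => phi B _ _; by rewrite normr0 mul0r.
by apply/wnorm_lt; exists (fun=> 0); [exact: fourier_rep0|rewrite l2norm0].
Qed.

Definition wzero : wspace := WSpace in_wspace0.

End weighted_space.

Section weights.
Variables (R : realType) (n : nat) (s : R).
Local Notation pt := 'rV[R]_n.+1.

Definition sobolev_weight (xi : pt) : R := bracket xi `^ (2 * s).

Definition aniso_weight (xi : pt) : R :=
  if enorm xi < 1 then enorm xi ^- 2 * (xi 0 ord0 ^+ 2 + enorm xi ^+ 4)
  else bracket xi `^ (2 * s).

Let sobolev_weightP : measurable_fun setT sobolev_weight.
Proof. exact: (measurableT_comp (measurable_powR _) (@measurable_bracket R n)). Qed.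

HB.instance Definition _ :=
  @isMeasurableFun.Build _ _ pt R sobolev_weight sobolev_weightP.

Let aniso_weightP : measurable_fun setT aniso_weight.
Proof.
apply: measurable_fun_ifT.
- exact: (measurable_fun_ltr (@measurable_enorm R n) (measurable_cst _)).
- apply: measurable_funM.
    rewrite (_ : (fun _ => _) = (fun xi : pt => enorm xi `^ (- 2))).
      exact: (measurableT_comp (measurable_powR _) (@measurable_enorm R n)).
    by apply/funext => xi; rewrite powR_invn// sqrtr_ge0.
  apply: measurable_funD; apply: measurable_funX; first exact: measurable_coord.
  exact: measurable_enorm.
- exact: sobolev_weightP.
Qed.

HB.instance Definition _ :=
  @isMeasurableFun.Build _ _ pt R aniso_weight aniso_weightP.

End weights.

(* For a natural number s, H^s(R^d) and the anisotropic space of order s.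
   Vector- and matrix-valued spaces are matrices of such distributions, with the
   product topology. *)
Notation sobolev R n s := (wspace (@sobolev_weight R n s%:R)).
Notation anisobolev R n s := (wspace (@aniso_weight R n s%:R)).

Section operators.
Variables (R : realType) (n : nat).
Local Notation pt := 'rV[R]_n.+1.
Local Open Scope complex_scope.

Definition dpartial (j : 'I_n.+1) (f : functional R n) : functional R n :=
  fun phi => if `[< schwartz phi >] then - f (partial j phi) else 0.

Definition dlaplacian (f : functional R n) : functional R n :=
  fun phi => \sum_j dpartial j (dpartial j f) phi.

(* <c nabla>^2 = 1 - c^2 Delta *)
Definition dbracket2 (c : R) (f : functional R n) : functional R n :=
  f \- (c ^+ 2 \*o dlaplacian f).

(* g is the image of f under the Fourier multiplier with real symbol m. *)
Definition fmultiplier (m : pt -> R) (f g : functional R n) : Prop :=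
  tempered g /\ exists F : pt -> R[i],
    fourier_rep f F /\ fourier_rep g (fun xi => (m xi)%:C * F xi).

(* The distribution f is the continuous function u. *)
Definition represents (f : functional R n) (u : pt -> R) : Prop :=
  continuous u /\
  forall phi, test_fun phi -> f phi = \int[leb R n.+1]_x (u x * phi x).

End operators.

Section shallow_water.
Variables (R : realType) (n l : nat).
Local Notation pt := 'rV[R]_n.+1.
Local Notation e1 := (delta_mx 0 0 : pt).

Definition gradient (f : pt -> R) (x : pt) : pt := \row_j partial j f x.

Definition laplacian (f : pt -> R) (x : pt) : R :=
  \sum_j partial j (partial j f) x.

Definition divergence (u : pt -> pt) (x : pt) : R :=
  \sum_j partial j (fun y => u y 0 j) x.

Definition mx_divergence (M : pt -> 'M[R]_n.+1) (x : pt) : pt :=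
  \row_i \sum_j partial j (fun y => M y i j) x.

(* (u . nabla) v *)
Definition advection (u v : pt -> pt) (x : pt) : pt :=
  \row_i \sum_j u x 0 j * partial j (fun y => v y 0 i) x.

Definition stress (v : pt -> pt) (x : pt) : 'M[R]_n.+1 :=
  \matrix_(i, j) (partial j (fun y => v y 0 i) x + partial i (fun y => v y 0 j) x)
  + (2 * divergence v x)%:M.

Definition shallow_water (gamma mu sigma : R) (force : pt -> pt)
    (v : pt -> pt) (eta : pt -> R) : Prop :=
  forall x,
    divergence (fun y => (1 + eta y) *: (v y - gamma *: e1)) x = 0 /\
    (1 + eta x) *: advection (fun y => v y - gamma *: e1) v x + v x
      - mu ^+ 2 *: mx_divergence (fun y => (1 + eta y) *: stress v y) x
      + (1 + eta x) *:
          \row_j (partial j eta x - sigma ^+ 2 * laplacian (partial j eta) x)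
      + force x = 0.

Definition forcing : Type :=
  R -> R -> ('I_l.+1 -> pt -> 'M[R]_n.+1) -> ('I_l.+1 -> pt -> pt) ->
  (pt -> R) -> pt -> pt.

(* Vectors are rows, so the product tau (grad eta) is (grad eta) *m tau^T. *)
Definition omnisonic_forcing : forcing := fun mu sigma tau phi eta x =>
  \sum_(i < l.+1) eta x ^+ i *:
    (\tr (tau i x) *: gradient eta x
     + (mu + sigma) *: (gradient eta x *m (tau i x)^T) + phi i x).

Definition subsonic_forcing : forcing := fun _ _ tau phi eta x =>
  \sum_(i < l.+1) eta x ^+ i *: (gradient eta x *m (tau i x)^T + phi i x).

Definition raw_data : Type :=
  'rV['M[functional R n]_n.+1]_l.+1 * 'rV['rV[functional R n]_n.+1]_l.+1.
Definition raw_state : Type := 'rV[functional R n]_n.+1 * functional R n.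

(* Parameters are triples (gamma, mu, sigma). *)
Definition solves_classically (F : forcing) (q : R * R * R) (w : raw_data)
    (z : raw_state) : Prop :=
  exists (tau : 'I_l.+1 -> pt -> 'M[R]_n.+1) (phi : 'I_l.+1 -> pt -> pt)
         (v : pt -> pt) (eta : pt -> R),
  [/\ forall i a b, represents (w.1 0 i a b) (fun x => tau i x a b),
      forall i a, represents (w.2 0 i 0 a) (fun x => phi i x 0 a),
      forall a, represents (z.1 0 a) (fun x => v x 0 a) /\
                Ck 2 (fun x => v x 0 a),
      represents z.2 eta /\ Ck 3 eta &
      shallow_water q.1.1 q.1.2 q.2 (F q.1.2 q.2 tau phi eta) v eta].

End shallow_water.

Arguments omnisonic_forcing {R n l}.
Arguments subsonic_forcing {R n l}.

(* The data space W_s: the pairs ({tau_i}, {phi_i}), 0 <= i <= l. *)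
Notation data R n l s :=
  ('rV['M[sobolev R n s]_n.+1]_l.+1 * 'rV['rV[sobolev R n s]_n.+1]_l.+1)%type.
Notation state R n s t := ('rV[sobolev R n s]_n.+1 * anisobolev R n t)%type.

Section bookkeeping.
Variables (R : realType) (n l : nat).

Definition of_data s (w : data R n l s) : raw_data R n l :=
  (map_mx (map_mx (@wdist R n _)) w.1, map_mx (map_mx (@wdist R n _)) w.2).

Definition of_state s t (z : state R n s t) : raw_state R n :=
  (map_mx (@wdist R n _) z.1, wdist z.2).

Definition zero_data s : data R n l s :=
  (const_mx (const_mx (wzero _)), const_mx (const_mx (wzero _))).

Definition zero_state s t : state R n s t := (const_mx (wzero _), wzero _).

(* The intersection of A, a subset of W_r, with W_s, as a subset of W_s. *)
Definition restrict_data r s (A : set (data R n l r)) : set (data R n l s) :=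
  [set w | exists2 w', A w' & of_data w' = of_data w].

(* The intersection of A with R^3 x W_s, as a subset of R^3 x W_s. *)
Definition restrict_params r s (A : set (R * R * R * data R n l r)) :
    set (R * R * R * data R n l s) :=
  [set x | @restrict_data r s [set w | A (x.1, w)] x.2].

Definition slice r (A : set (R * R * R * data R n l r)) (q : R * R * R) :
    set (data R n l r) :=
  interior [set w | A (q, w)].

Definition solution_in r t (F : forcing R n l)
    (V : R * R * R -> set (state R n r t))
    (q : R * R * R) (w : raw_data R n l) (z : state R n r t) : Prop :=
  V q z /\ solves_classically F q w (of_state z).

(* S is continuous on D, and S x is the solution singled out by sol x. *)
Definition solution_map (X : topologicalType) r t s s' (D : set X)
    (sol : X -> state R n r t -> Prop) (S : X -> state R n s s') : Prop :=
  {within D, continuous S} /\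
  forall x, D x -> exists2 z, sol x z & of_state z = of_state (S x).

(* A.1 = mu (nabla v) and A.2 = mu^2 (nabla^2 v). *)
Definition viscous_terms s (mu : R) (v : 'rV[functional R n]_n.+1)
    (A : 'M[sobolev R n s]_n.+1 * 'rV['M[sobolev R n s]_n.+1]_n.+1) : Prop :=
  (forall i j, wdist (A.1 i j) = mu \*o dpartial j (v 0 i)) /\
  (forall i j k, wdist (A.2 0 k i j) =
     mu ^+ 2 \*o dpartial k (dpartial j (v 0 i))).

(* B = (mu + sigma) (nabla eta, sigma nabla^2 eta, sigma^2 nabla^3 eta) *)
Definition omnisonic_surface_terms s (mu sigma : R) (eta : functional R n)
    (B : 'rV[sobolev R n s]_n.+1 * 'M[sobolev R n s]_n.+1 *
         'rV['M[sobolev R n s]_n.+1]_n.+1) : Prop :=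
  [/\ forall i, wdist (B.1.1 0 i) = (mu + sigma) \*o dpartial i eta,
      forall i j, wdist (B.1.2 i j) =
        ((mu + sigma) * sigma) \*o dpartial j (dpartial i eta) &
      forall i j k, wdist (B.2 0 k i j) =
        ((mu + sigma) * sigma ^+ 2) \*o
          dpartial k (dpartial j (dpartial i eta))].

(* B = (sigma nabla eta, sigma^2 nabla^2 eta) *)
Definition subsonic_surface_terms s (sigma : R) (eta : functional R n)
    (B : 'rV[sobolev R n s]_n.+1 * 'M[sobolev R n s]_n.+1) : Prop :=
  (forall i, wdist (B.1 0 i) = sigma \*o dpartial i eta) /\
  (forall i j, wdist (B.2 i j) = sigma ^+ 2 \*o dpartial j (dpartial i eta)).

End bookkeeping.

Arguments restrict_data {R n l r} s A.
Arguments restrict_params {R n l r} s A.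

Definition omnisonic_reg (n : nat) : nat := (19 + 2 * n.+1./2)%N.
Definition subsonic_reg (n : nat) : nat := (17 + 2 * n.+1./2)%N.

Section previously_fixed_sets.
Variables (R : realType) (n l : nat).
Local Notation reg := (omnisonic_reg n).
Local Notation subreg := (subsonic_reg n).

Definition omnisonic_params : set (R * R * R) :=
  [set q | [/\ 0 < q.1.1, 0 <= q.1.2 & 0 <= q.2]].

Definition subsonic_params : set (R * R * R) :=
  [set q | [/\ 0 < q.1.1 < 1, 0 <= q.1.2 & 0 <= q.2]].

(* What small-data well-posedness provides: solvability sets U_s, neighbourhoods
   V(gamma, mu, sigma) in which solutions are unique, regularity of the solutions
   and continuous dependence on parameters and data. *)
Record omnisonic_sets (U : nat -> set (R * R * R * data R n l reg))
    (V : R * R * R -> set (state R n reg reg)) : Prop := {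
  omni_nonincreasing : forall s s',
    (reg <= s)%N -> (s <= s')%N -> U s' `<=` U s ;
  omni_relatively_open : forall s, (reg <= s)%N ->
    exists2 O, open O & U s = O `&` (omnisonic_params `*` setT) ;
  omni_zero : forall s q, (reg <= s)%N -> omnisonic_params q ->
    U s (q, zero_data R n l reg) ;
  omni_V_open : forall q, omnisonic_params q ->
    open (V q) /\ V q (zero_state R n reg reg) ;
  omni_solvable : forall q w, U reg (q, w) ->
    exists! z, solution_in omnisonic_forcing V q (of_data w) z ;
  omni_regular : forall s q (w : data R n l s) z, (reg <= s)%N ->
    restrict_params s (U s) (q, w) ->
    solution_in omnisonic_forcing V q (of_data w) z ->
    (forall i, in_wspace (@sobolev_weight R n s%:R)
                 (dbracket2 q.1.2 ((of_state z).1 0 i))) /\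
    (exists2 g,
      fmultiplier (fun xi => 1 + (q.1.2 + q.2) * (2 * pi * enorm xi))
        (dbracket2 q.2 (of_state z).2) g &
      in_wspace (@aniso_weight R n s%:R) g) ;
  omni_continuous : forall s, (reg <= s)%N ->
    exists S : R * R * R * data R n l s -> state R n s s,
    [/\ solution_map (restrict_params s (U s))
          (fun x => solution_in omnisonic_forcing V x.1 (of_data x.2)) S,
        exists A, {within restrict_params s (U s), continuous A} /\
          forall x, restrict_params s (U s) x ->
            @viscous_terms R n s x.1.1.2 (of_state (S x)).1 (A x) &
        exists B, {within restrict_params s (U s), continuous B} /\
          forall x, restrict_params s (U s) x ->
            @omnisonic_surface_terms R n s x.1.1.2 x.1.2 (of_state (S x)).2 (B x)]
}.

Record subsonic_sets (U : nat -> set (R * R * R * data R n l subreg))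
    (V : R * R * R -> set (state R n subreg subreg.+1)) : Prop := {
  sub_nonincreasing : forall s s',
    (subreg <= s)%N -> (s <= s')%N -> U s' `<=` U s ;
  sub_relatively_open : forall s, (subreg <= s)%N ->
    exists2 O, open O & U s = O `&` (subsonic_params `*` setT) ;
  sub_zero : forall s q, (subreg <= s)%N -> subsonic_params q ->
    U s (q, zero_data R n l subreg) ;
  sub_V_open : forall q, subsonic_params q ->
    open (V q) /\ V q (zero_state R n subreg subreg.+1) ;
  sub_solvable : forall q w, U subreg (q, w) ->
    exists! z, solution_in subsonic_forcing V q (of_data w) z ;
  sub_regular : forall s q (w : data R n l s) z, (subreg <= s)%N ->
    restrict_params s (U s) (q, w) ->
    solution_in subsonic_forcing V q (of_data w) z ->
    (forall i, in_wspace (@sobolev_weight R n s%:R)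
                 (dbracket2 q.1.2 ((of_state z).1 0 i))) /\
    in_wspace (@aniso_weight R n s.+1%:R) (dbracket2 q.2 (of_state z).2) ;
  sub_continuous : forall s, (subreg <= s)%N ->
    exists S : R * R * R * data R n l s -> state R n s s.+1,
    [/\ solution_map (restrict_params s (U s))
          (fun x => solution_in subsonic_forcing V x.1 (of_data x.2)) S,
        exists A, {within restrict_params s (U s), continuous A} /\
          forall x, restrict_params s (U s) x ->
            @viscous_terms R n s x.1.1.2 (of_state (S x)).1 (A x) &
        exists B, {within restrict_params s (U s), continuous B} /\
          forall x, restrict_params s (U s) x ->
            @subsonic_surface_terms R n s.+1 x.1.2 (of_state (S x)).2 (B x)]
}.

End previously_fixed_sets.

(* Main.v *)
Require Import Defs.
From mathcomp Require Import all_boot all_order all_algebra.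
From mathcomp Require Import all_classical all_reals all_analysis.

Import Order.TTheory GRing.Theory Num.Theory.
Import numFieldNormedType.Exports.

Local Open Scope classical_set_scope.
Local Open Scope ring_scope.

Set Implicit Arguments.
Unset Strict Implicit.

(* Fixing gamma, the parameters (mu, sigma) range over a compact rectangle, so by
   the tube lemma a relatively open set of parameters and data which contains
   zero data at every parameter contains a whole neighbourhood of zero data,
   uniformly over the rectangle. Continuity of the solutions in (mu, sigma) is
   the restriction of the joint continuous dependence on parameters and data. *)

(** Serves to pull joint continuity in parameters and data back to the rectangle of pairs (mu,
    sigma), along a map that freezes gamma and the data. *)
Lemma within_continuous_precomp (X Y Z : topologicalType) (D : set X) (E : set Y)
    (f : X -> Y) (g : Y -> Z) :
  continuous f -> D `<=` f @^-1` E ->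
  {within E, continuous g} -> {within D, continuous (g \o f)}.
Proof.
move=> cf DE /subspace_continuousP cg; apply/subspace_continuousP => x Dx.
apply: cvg_trans (cg _ (DE _ Dx)) => A /=.
move=> /(cf x); apply: (@filterS _ (nbhs x)) => y hy Dy.
exact: hy (DE _ Dy).
Qed.

(** Tube lemma for a set open only relative to [P]: compactness makes the neighbourhoods of [y]
    uniform over [K], and the constraint [P] holds on all of [K]. *)
Lemma tube_nbhs (X Y : topologicalType) (K P : set X) (O : set (X * Y)) (y : Y) :
  compact K -> K `<=` P -> open O ->
  (forall x, K x -> (O `&` (P `*` setT)) (x, y)) ->
  nbhs y [set z | forall x, K x -> (O `&` (P `*` setT)) (x, z)].
Proof.
move=> /compact_near_coveringP cK KP oO Oy.
have : \near y, K `<=` (fun x => O (x, y)).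
  (* In near-covering form, compactness asks only for a local statement: near each [(x, y)] all
     pairs lie in [O]. *)
  apply: cK => x /Oy[Oxy _].
  have : nbhs (x, y) O by exact: open_nbhs_nbhs.
  by apply: filterS => -[].
apply: filterS => z Oz x Kx; split; first exact: Oz.
by split => //; exact: KP.
Qed.

(** An infinite intersection of slices need not be open, so the interior is taken after intersecting
    over [K]; the tube lemma keeps the zero data inside. *)
Definition uniform_slice {R : realType} {n l r : nat} (K : set (R * R * R))
    (A : set (R * R * R * data R n l r)) : set (data R n l r) :=
  interior [set w | forall q, K q -> A (q, w)].

(** The wave speed stays as a singleton factor, so that this is a compact subset of the full
    parameter space. *)
Definition param_rectangle {R : realType} (gamma a b : R) : set (R * R * R) :=
  ([set gamma] `*` `[0, a]) `*` `[0, b].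

Lemma compact_param_rectangle (R : realType) (gamma a b : R) :
  compact (param_rectangle gamma a b).
Proof.
apply: compact_setX; last exact: segment_compact.
by apply: compact_setX; [exact: compact_set1|exact: segment_compact].
Qed.

Lemma param_rectangleP (R : realType) (gamma a b : R) (p : R * R) :
  (`[0, a] `*` `[0, b]) p -> param_rectangle gamma a b (gamma, p.1, p.2).
Proof. by case. Qed.

Lemma uniform_slice_slice (R : realType) (n l r : nat) (gamma a b : R)
    (A : set (R * R * R * data R n l r)) :
  uniform_slice (param_rectangle gamma a b) A `<=`
    \bigcap_(mu in `[0, a]) \bigcap_(sigma in `[0, b]) slice A (gamma, mu, sigma).
Proof.
move=> w Aw mu hmu sigma hsigma; apply: interiorS Aw => z; apply.
exact: (@param_rectangleP _ gamma a b (mu, sigma)).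
Qed.

Lemma restrict_uniform_slice (R : realType) (n l r s : nat) (K : set (R * R * R))
    (A : set (R * R * R * data R n l r)) (w : data R n l s) (q : R * R * R) :
  restrict_data s (uniform_slice K A) w -> K q -> restrict_params s A (q, w).
Proof. by move=> [w' /interior_subset Aw' ww'] Kq; exists w' => //; exact: Aw'. Qed.

Lemma continuous_pair (X Y Z : topologicalType) (f : X -> Y) (g : X -> Z) :
  continuous f -> continuous g -> continuous (fun x => (f x, g x)).
Proof. by move=> cf cg x; apply: cvg_pair; [exact: cf|exact: cg]. Qed.

Lemma continuous_param (R : realType) (T : topologicalType) (gamma : R) (w : T) :
  continuous (fun p : R * R => ((gamma, p.1, p.2), w)).
Proof.
apply: continuous_pair; last exact: cst_continuous.
apply: continuous_pair; last by move=> [a b]; exact: cvg_snd.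
apply: continuous_pair; first exact: cst_continuous.
by move=> [a b]; exact: cvg_fst.
Qed.

(** Both maps represent the same unique base-regularity solution. The comparison is made on
    underlying distributions, since that solution lives in a different space from the values of [S]
    and [S']. *)
Lemma solution_map_unique (R : realType) (n r t s s' : nat) (X : topologicalType)
    (D : set X) (sol : X -> state R n r t -> Prop) (S S' : X -> state R n s s') :
  (forall x, D x -> exists! z, sol x z) ->
  solution_map D sol S -> solution_map D sol S' ->
  forall x, D x -> of_state (S x) = of_state (S' x).
Proof.
move=> solU [_ hS] [_ hS'] x Dx.
have [z [_ zU]] := solU x Dx.
have [y soly <-] := hS x Dx; have [y' soly' <-] := hS' x Dx.
by rewrite -(zU _ soly) -(zU _ soly').
Qed.

Lemma solution_map_precomp (R : realType) (n r t s s' : nat)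
    (X Y : topologicalType) (D : set X) (E : set Y) (f : X -> Y)
    (sol : Y -> state R n r t -> Prop) (S : Y -> state R n s s') :
  continuous f -> D `<=` f @^-1` E ->
  solution_map E sol S -> solution_map D (sol \o f) (S \o f).
Proof.
move=> cf DE [cS hS]; split; first exact: within_continuous_precomp cS.
by move=> x /DE Efx; exact: hS.
Qed.

Unset Implicit Arguments.
Set Strict Implicit.

Theorem corollary5p4 (R : realType) (n l : nat)
    (U : nat -> set (R * R * R * data R n l (omnisonic_reg n)))
    (V : R * R * R -> set (state R n (omnisonic_reg n) (omnisonic_reg n)))
    (Usub : nat -> set (R * R * R * data R n l (subsonic_reg n)))
    (Vsub : R * R * R -> set (state R n (subsonic_reg n) (subsonic_reg n).+1))
    (hUV : omnisonic_sets U V) (hUVsub : subsonic_sets Usub Vsub)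
    (gamma Rvisc Rsurf : R)
    (gamma_gt0 : 0 < gamma) (Rvisc_gt0 : 0 < Rvisc) (Rsurf_gt0 : 0 < Rsurf) :
  (exists Ut : nat -> set (data R n l (omnisonic_reg n)),
    [/\ forall s s', (omnisonic_reg n <= s)%N -> (s <= s')%N -> Ut s' `<=` Ut s,
        forall s, (omnisonic_reg n <= s)%N ->
          open (Ut s) /\ Ut s (zero_data R n l (omnisonic_reg n)),
        forall s, (omnisonic_reg n <= s)%N ->
          Ut s `<=` \bigcap_(mu in `[0, Rvisc]) \bigcap_(sigma in `[0, Rsurf])
                      slice (U s) (gamma, mu, sigma) &
        forall s (w : data R n l s), (omnisonic_reg n <= s)%N ->
          restrict_data s (Ut s) w ->
          let D : set (R * R) := `[0, Rvisc] `*` `[0, Rsurf] in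
          let is_solution_map (S : R * R -> state R n s s) :=
            solution_map D (fun p =>
              solution_in omnisonic_forcing V (gamma, p.1, p.2) (of_data w)) S in
          (exists S, is_solution_map S) /\
          forall S, is_solution_map S ->
            (exists A, {within D, continuous A} /\ forall p, D p ->
               @viscous_terms R n s p.1 (of_state (S p)).1 (A p)) /\
            (exists B, {within D, continuous B} /\ forall p, D p ->
               @omnisonic_surface_terms R n s p.1 p.2 (of_state (S p)).2 (B p))])
  /\
  (gamma < 1 ->
   exists Ut : nat -> set (data R n l (subsonic_reg n)),
    [/\ forall s s', (subsonic_reg n <= s)%N -> (s <= s')%N -> Ut s' `<=` Ut s,
        forall s, (subsonic_reg n <= s)%N ->
          open (Ut s) /\ Ut s (zero_data R n l (subsonic_reg n)),
        forall s, (subsonic_reg n <= s)%N ->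
          Ut s `<=` \bigcap_(mu in `[0, Rvisc]) \bigcap_(sigma in `[0, Rsurf])
                      slice (Usub s) (gamma, mu, sigma) &
        forall s (w : data R n l s), (subsonic_reg n <= s)%N ->
          restrict_data s (Ut s) w ->
          let D : set (R * R) := `[0, Rvisc] `*` `[0, Rsurf] in
          let is_solution_map (S : R * R -> state R n s s.+1) :=
            solution_map D (fun p =>
              solution_in subsonic_forcing Vsub (gamma, p.1, p.2) (of_data w)) S in
          (exists S, is_solution_map S) /\
          forall S, is_solution_map S ->
            (exists A, {within D, continuous A} /\ forall p, D p ->
               @viscous_terms R n s p.1 (of_state (S p)).1 (A p)) /\
            (exists B, {within D, continuous B} /\ forall p, D p ->
               @subsonic_surface_terms R n s.+1 p.2 (of_state (S p)).2 (B p))]).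
Proof.
set K := param_rectangle gamma Rvisc Rsurf.
have cK : compact K by exact: compact_param_rectangle.
split.
  have KP : K `<=` @omnisonic_params R.
    move=> [[c a] b] [[/= -> ]]; rewrite /= !in_itv/= => /andP[? _] /andP[? _].
    by split.
  exists (fun s => uniform_slice K (U s)); split.
  + move=> s s' hs ss'; apply: interiorS => w Uw q Kq.
    exact: (omni_nonincreasing hUV hs ss' (Uw q Kq)).
  + move=> s hs; split; first exact: open_interior.
    (* Zero data are admissible at every point of [K], so the tube lemma gives a whole neighbourhood
       of them. *)
    have [G oG UG] := omni_relatively_open hUV hs.
    rewrite /uniform_slice UG; apply: (tube_nbhs cK KP oG) => // q Kq.
    by rewrite -UG; apply: (omni_zero hUV) => //; exact: KP.
  + by move=> s hs; exact: uniform_slice_slice.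
  move=> s w hs Uw D is_solution_map.
  have DU p : D p -> restrict_params s (U s) (gamma, p.1, p.2, w).
    by move=> /(param_rectangleP gamma); exact: restrict_uniform_slice.
  (* All maps required on the rectangle are pullbacks along this insertion of the fixed [gamma] and
     [w]. *)
  pose f (p : R * R) := ((gamma, p.1, p.2), w).
  have cf : continuous f by exact: continuous_param.
  have solU p : D p -> exists! z,
      solution_in omnisonic_forcing V (gamma, p.1, p.2) (of_data w) z.
    (* Unique solvability is given at the base index, so the rough copy [w'] of the data is moved
       from [U s] into the larger base set. *)
    move=> /DU[w' Uw' /= <-]; apply: (omni_solvable hUV).
    exact: (omni_nonincreasing hUV (leqnn _) hs Uw').
  have [S0 [solS0 [A [cA hA]] [B [cB hB]]]] := omni_continuous hUV hs.
  have sol := solution_map_precomp cf DU solS0.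
  split; first by eexists; exact: sol.
  (* The derivative terms are supplied for [S0] only; uniqueness transfers them to an arbitrary
     solution map [S]. *)
  move=> S solS; have SE := solution_map_unique solU solS sol.
  split; [exists (A \o f)|exists (B \o f)];
    (split; [exact: (within_continuous_precomp cf DU)|move=> p Dp; rewrite SE//]).
    exact: (hA _ (DU p Dp)).
  exact: (hB _ (DU p Dp)).
move=> gamma_lt1.
(* Here [gamma < 1] places the rectangle among the subsonic parameters; the omnisonic argument then
   repeats with the subsonic sets. *)
have KP : K `<=` @subsonic_params R.
  move=> [[c a] b] [[/= -> ]]; rewrite /= !in_itv/= => /andP[? _] /andP[? _].
  by split => //; rewrite gamma_gt0.
exists (fun s => uniform_slice K (Usub s)); split.
+ move=> s s' hs ss'; apply: interiorS => w Uw q Kq.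
  exact: (sub_nonincreasing hUVsub hs ss' (Uw q Kq)).
+ move=> s hs; split; first exact: open_interior.
  have [G oG UG] := sub_relatively_open hUVsub hs.
  rewrite /uniform_slice UG; apply: (tube_nbhs cK KP oG) => // q Kq.
  by rewrite -UG; apply: (sub_zero hUVsub) => //; exact: KP.
+ by move=> s hs; exact: uniform_slice_slice.
move=> s w hs Uw D is_solution_map.
have DU p : D p -> restrict_params s (Usub s) (gamma, p.1, p.2, w).
  by move=> /(param_rectangleP gamma); exact: restrict_uniform_slice.
pose f (p : R * R) := ((gamma, p.1, p.2), w).
have cf : continuous f by exact: continuous_param.
have solU p : D p -> exists! z,
      solution_in subsonic_forcing Vsub (gamma, p.1, p.2) (of_data w) z.
  move=> /DU[w' Uw' /= <-]; apply: (sub_solvable hUVsub).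
  exact: (sub_nonincreasing hUVsub (leqnn _) hs Uw').
have [S0 [solS0 [A [cA hA]] [B [cB hB]]]] := Defs.sub_continuous hUVsub hs.
have sol := solution_map_precomp cf DU solS0.
split; first by eexists; exact: sol.
(* Again every solution map has the same distributions as [S0 \o f], so [A \o f] and [B \o f] serve
   for it too. *)
move=> S solS; have SE := solution_map_unique solU solS sol.
split; [exists (A \o f)|exists (B \o f)];
  (split; [exact: (within_continuous_precomp cf DU)|move=> p Dp; rewrite SE//]).
  exact: (hA _ (DU p Dp)).
exact: (hB _ (DU p Dp)).
Qed.
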